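(* Let $B$ be a unital $\mathbb K$-algebra. The map $(f,g)\mapsto\{f,g\}$ defines a right pre-Lie product on $\mathfrak g_B^{\mathrm{inv}}$, i.e. for all $f,g,h\in\mathfrak g_B^{\mathrm{inv}}$, $$\{f,\{g,h\}\}-\{\{f,g\},h\}=\{f,\{h,g\}\}-\{\{f,h\},g\}.$$
   Context: $\mathbb K$ is a field of characteristic zero. For a unital $\mathbb K$-algebra $B$, $\mathrm{Mult}[[B]]$ is the $\mathbb K$-vector space of sequences $f=(f_n)_{n\ge0}$ of $\mathbb K$-multilinear maps $f_n:B^{\otimes n}\to B$ (with $B^{\otimes 0}=\mathbb K$, so $f_0$ is identified with an element of $B$), and $\mathfrak g_B^{\mathrm{inv}}:=\{f\in\mathrm{Mult}[[B]]: f_0=0\}$. For $f,g\in\mathfrak g_B^{\mathrm{inv}}$, $\{f,g\}\in\mathfrak g_B^{\mathrm{inv}}$ is the series with, for $N\ge1$, $$\{f,g\}_N(x_1,\dots,x_N)=\sum_{\substack{n,m\ge1\\ n+m=N+1}}\ \sum_{i=1}^n f_n\big(x_1,\dots,x_{i-1},g_m(x_i,\dots,x_{i+m-1}),x_{i+m},\dots,x_N\big).$$ *)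

(* Defs.v *)
From HB Require Import structures.
From mathcomp Require Import all_boot all_algebra.
From mathcomp Require Import boolp functions zify.

Set Implicit Arguments.
Unset Strict Implicit.
Unset Printing Implicit Defensive.

Import GRing.Theory.
Local Open Scope ring_scope.

Section Multilinear.
Variables (K : fieldType) (B : lmodType K) (n : nat).

Definition tset (x : n.-tuple B) (i : 'I_n) (y : B) : n.-tuple B :=
  [tuple if j == i then y else tnth x j | j < n].

(* For n = 0 the condition is void: a 0-ary map is an element of B. *)
Definition multilinear (f : n.-tuple B -> B) : Prop :=
  forall (x : n.-tuple B) (i : 'I_n), linear (fun y => f (tset x i y)).

Definition multilinearb : {pred (n.-tuple B -> B)} :=
  fun f => `[< multilinear f >].

Record multmap := MultMap {
  multmap_fun :> n.-tuple B -> B;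
  _ : multmap_fun \in multilinearb }.

HB.instance Definition _ := [isSub for multmap_fun].
HB.instance Definition _ := [Choice of multmap by <:].

Fact multilinearb_submod_closed : submod_closed multilinearb.
Proof.
split=> [|c f g /asboolP f_lin /asboolP g_lin]; apply/asboolP.
  by move=> x i a u v; rewrite scaler0 addr0.
move=> x i a u v; rewrite /= !fctE f_lin g_lin.
rewrite !scalerDr !scalerA [c * a]mulrC.
by rewrite !addrA; congr (_ + _); rewrite -!addrA; congr (_ + _); rewrite addrC.
Qed.

HB.instance Definition _ :=
  GRing.SubChoice_isSubLmodule.Build K (n.-tuple B -> B) multilinearb multmap
    (GRing.submod_closed_semi multilinearb_submod_closed).

Lemma multmapP (f : multmap) : multilinear f.
Proof. by case: f => f /= /asboolP. Qed.

End Multilinear.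

(* Mult[[B]]: the K-multilinear maps B^{(x) n} -> B are taken as multilinear
   maps on n-tuples. *)
Definition Mult (K : fieldType) (B : lmodType K) : Type :=
  forall n : nat, multmap B n.

Section MultLmodule.
Variables (K : fieldType) (B : lmodType K).
Implicit Types f g h : Mult B.

HB.instance Definition _ := gen_eqMixin (Mult B).
HB.instance Definition _ := gen_choiceMixin (Mult B).

Definition Mult_zero : Mult B := fun=> 0.
Definition Mult_opp f : Mult B := fun n => - f n.
Definition Mult_add f g : Mult B := fun n => f n + g n.
Definition Mult_scale (a : K) f : Mult B := fun n => a *: f n.

Fact Mult_addA : associative Mult_add.
Proof. by move=> f g h; apply: functional_extensionality_dep => n; apply: addrA. Qed.
Fact Mult_addC : commutative Mult_add.
Proof. by move=> f g; apply: functional_extensionality_dep => n; apply: addrC. Qed.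
Fact Mult_add0 : left_id Mult_zero Mult_add.
Proof. by move=> f; apply: functional_extensionality_dep => n; apply: add0r. Qed.
Fact Mult_addN : left_inverse Mult_zero Mult_opp Mult_add.
Proof. by move=> f; apply: functional_extensionality_dep => n; apply: addNr. Qed.

HB.instance Definition _ :=
  GRing.isZmodule.Build (Mult B) Mult_addA Mult_addC Mult_add0 Mult_addN.

Fact Mult_scaleA a b f : Mult_scale a (Mult_scale b f) = Mult_scale (a * b) f.
Proof. by apply: functional_extensionality_dep => n; apply: scalerA. Qed.
Fact Mult_scale1 : left_id 1 Mult_scale.
Proof. by move=> f; apply: functional_extensionality_dep => n; apply: scale1r. Qed.
Fact Mult_scaleDr : right_distributive Mult_scale +%R.
Proof. by move=> a f g; apply: functional_extensionality_dep => n; apply: scalerDr. Qed.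
Fact Mult_scaleDl f : {morph Mult_scale^~ f : a b / a + b}.
Proof. by move=> a b; apply: functional_extensionality_dep => n; apply: scalerDl. Qed.

HB.instance Definition _ :=
  GRing.Zmodule_isLmodule.Build K (Mult B)
    Mult_scaleA Mult_scale1 Mult_scaleDr Mult_scaleDl.

End MultLmodule.

Section Ginv.
Variables (K : fieldType) (B : lmodType K).

Definition const0 : {pred Mult B} := fun f => f 0%N == 0.

(* g_B^inv *)
Record ginv := Ginv {
  ginv_series :> Mult B;
  _ : ginv_series \in const0 }.

HB.instance Definition _ := [isSub for ginv_series].
HB.instance Definition _ := [Choice of ginv by <:].

Fact const0_submod_closed : submod_closed const0.
Proof.
split=> [|a f g /eqP f0 /eqP g0]; apply/eqP => //.
by rewrite -[LHS]/(a *: f 0%N + g 0%N) f0 g0 scaler0 addr0.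
Qed.

HB.instance Definition _ :=
  GRing.SubChoice_isSubLmodule.Build K (Mult B) const0 ginv
    (GRing.submod_closed_semi const0_submod_closed).

End Ginv.

Section Bracket.
Variables (K : fieldType) (B : lmodType K).

(* With positions counted from 0, slice x i m is (x_i, ..., x_{i+m-1}), and
   plug x i m n y is (x_0, ..., x_{i-1}, y, x_{i+m}, ..., x_{N-1}). When
   n + m = N + 1 and i < n, the lengths agree and the default value of nth is
   never reached. *)
Definition slice N (x : N.-tuple B) (i m : nat) : m.-tuple B :=
  [tuple nth 0 x (i + j)%N | j < m].

Definition plug N (x : N.-tuple B) (i m n : nat) (y : B) : n.-tuple B :=
  [tuple nth 0 (take i x ++ y :: drop (i + m)%N x) j | j < n].

(* For N = 0 the sum is empty. *)
Definition bracket_fun (f g : Mult B) N (x : N.-tuple B) : B :=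
  \sum_(1 <= n < N.+1) \sum_(1 <= m < N.+1 | (n + m == N.+1)%N)
    \sum_(i < n) f n (plug x i m n (g m (slice x i m))).

Lemma nth_tset N (x : N.-tuple B) (l : 'I_N) y k :
  nth 0 (tset x l y) k = if k == l then y else nth 0 x k.
Proof.
have [kN|Nk] := ltnP k N; last first.
  rewrite !nth_default ?size_tuple //.
  by case: eqP => // kl; move: Nk; rewrite kl leqNgt ltn_ord.
rewrite -[k]/(nat_of_ord (Ordinal kN)) -!tnth_nth tnth_mktuple.
by rewrite -val_eqE.
Qed.

Lemma nth_plug N (x : N.-tuple B) (i m : nat) y k : (i <= N)%N ->
  nth 0 (take i x ++ y :: drop (i + m)%N x) k =
  if (k < i)%N then nth 0 x k else
  if k == i then y else nth 0 x (k + m).-1.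
Proof.
move=> iN; rewrite nth_cat size_takel ?size_tuple //.
case: ltnP => [ki|ik]; first by rewrite nth_take.
have [d ->] : exists d, k = (i + d)%N by exists (k - i)%N; lia.
rewrite addKn; case: d => [|d] /=; first by rewrite addn0 eqxx.
by rewrite ifF ?nth_drop; [congr (nth _ _ _)|apply/negbTE]; lia.
Qed.

Lemma bracket_term_multilinear (f g : Mult B) N n m i :
    (n + m)%N = N.+1 -> (i < n)%N ->
  multilinear (fun x : N.-tuple B => f n (plug x i m n (g m (slice x i m)))).
Proof.
move=> nmN i_n x l a u v /=.
have iN : (i <= N)%N by lia.
have lN := ltn_ord l.
have [/andP[il lim]|l_out] := boolP (i <= l < i + m)%N.
  have l'm : (l - i < m)%N by lia.
  have sliceE y : slice (tset x l y) i m = tset (slice x i m) (Ordinal l'm) y.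
    apply: eq_from_tnth => j; rewrite !tnth_mktuple nth_tset -val_eqE /=.
    by congr (if _ then _ else _); lia.
  have plugE y z : plug (tset x l y) i m n z
      = tset (plug x i m n 0) (Ordinal i_n) z.
    apply: eq_from_tnth => j; rewrite !tnth_mktuple !nth_plug // !nth_tset.
    rewrite -val_eqE /=; case: (ltngtP (j : nat) i) => // jl.
      by rewrite ifF //; apply/negbTE; lia.
    by rewrite ifF //; apply/negbTE; lia.
  by rewrite !plugE !sliceE multmapP multmapP.
have l'n : ((if l < i then l : nat else (l - m).+1) < n)%N.
  by case: ifP => li; lia.
have sliceE y : slice (tset x l y) i m = slice x i m.
  apply: eq_from_tnth => j; rewrite !tnth_mktuple nth_tset.
  by have jm := ltn_ord j; rewrite ifF //; apply/negbTE; lia.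
have plugE y z : plug (tset x l y) i m n z
    = tset (plug x i m n z) (Ordinal l'n) y.
  apply: eq_from_tnth => j; rewrite !tnth_mktuple !nth_plug // !nth_tset.
  rewrite -val_eqE /=; case: (ltnP l i) => li /=;
    case: (ltngtP (j : nat) i) => ji //=;
    first [by congr (if _ then _ else _); lia
          |by rewrite !ifF //; apply/negbTE; lia].
by rewrite !sliceE !plugE multmapP.
Qed.

Lemma bracket_fun_multilinear (f g : Mult B) N :
  @bracket_fun f g N \in @multilinearb K B N.
Proof.
apply/asboolP => x l a u v; rewrite /bracket_fun.
rewrite scaler_sumr -big_split; apply: eq_bigr => n _.
rewrite scaler_sumr -big_split; apply: eq_bigr => m /eqP nmN.
rewrite scaler_sumr -big_split; apply: eq_bigr => i _.
exact: (bracket_term_multilinear f g nmN (ltn_ord i)).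
Qed.

Definition bracket_series (f g : Mult B) : Mult B :=
  fun N => MultMap (bracket_fun_multilinear f g N).

Lemma bracket_series_const0 (f g : Mult B) : bracket_series f g \in @const0 K B.
Proof.
by apply/eqP/val_inj/funext => x /=; rewrite /bracket_fun big_geq.
Qed.

Definition bracket (f g : ginv B) : ginv B :=
  Ginv (bracket_series_const0 f g).

End Bracket.

Definition right_preLie (K : fieldType) (V : lmodType K) (p : V -> V -> V) :
    Prop :=
  [/\ forall g, linear (p^~ g),
      forall f, linear (p f)
    & forall f g h,
        p f (p g h) - p (p f g) h = p f (p h g) - p (p f h) g].

(* Main.v *)
Require Import Defs.
From mathcomp Require Import all_boot all_algebra.
From mathcomp Require Import boolp zify.

(** Why the identity holds.  View a series [f] as one function on words over
    [B], of value [f_n] on the words of length [n].  Then [{f, g}] sends a word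
    [s] to the sum, over all factorisations [s = a ++ b ++ c], of
    [f (a ++ g b :: c)]: the letters of [b] are contracted to one letter
    ([ev_bracket]).  Factorisations with [b] empty add nothing as [g_0 = 0], and
    admitting them removes every boundary case.

    In [{{f, g}, h}], first a factor [b] is contracted by [h] to one letter, and
    then a factor of the new word is contracted by [g].  The second factor
    contains the letter made by [h], or lies before it, or lies after it.  The
    first case gives exactly [{f, {g, h}}], by multilinearity of [f]; the other
    two give the sum of [f (a ++ h b :: c ++ g d :: e)] over
    [s = a ++ b ++ c ++ d ++ e] and the same sum with [g] and [h] exchanged
    ([insertion_comp]).  Hence [{{f, g}, h} - {f, {g, h}}] is symmetric in [g]
    and [h].

    On the level of sums, two facts are enough: factoring a word into three
    through its left part or through its right part gives the same
    factorisations ([sum_splitsA]), and a cut of [a ++ y :: c] falls either in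
    [a] or in [c] ([sum_splits_cat]). *)

Set Implicit Arguments.
Unset Strict Implicit.
Unset Printing Implicit Defensive.

Import GRing.Theory.
Local Open Scope ring_scope.

(** * Sums over the factorisations of a word *)

Section SumSplits.
Variables (T : Type) (V : zmodType).
Implicit Types (P : seq T -> seq T -> V) (s : seq T).

Definition sum_splits P s : V := \sum_(i < (size s).+1) P (take i s) (drop i s).

Lemma sum_splits_nil P : sum_splits P [::] = P [::] [::].
Proof. by rewrite /sum_splits big_ord1. Qed.

Lemma sum_splits_cons P x s :
  sum_splits P (x :: s) = P [::] (x :: s) + sum_splits (fun a => P (x :: a)) s.
Proof. by rewrite /sum_splits big_ord_recl. Qed.

Lemma eq_sum_splits P Q s :
  (forall a b, P a b = Q a b) -> sum_splits P s = sum_splits Q s.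
Proof. by move=> PQ; apply: eq_bigr => i _. Qed.

Lemma sum_splitsD P Q s :
  sum_splits (fun a b => P a b + Q a b) s = sum_splits P s + sum_splits Q s.
Proof. exact: big_split. Qed.

Lemma exchange_sum_splits (P : seq T -> seq T -> seq T -> seq T -> V) s t :
  sum_splits (fun a b => sum_splits (P a b) t) s =
  sum_splits (fun c d => sum_splits (fun a b => P a b c d) s) t.
Proof. exact: exchange_big. Qed.

(** Coassociativity of deconcatenation. *)
Lemma sum_splitsA (P : seq T -> seq T -> seq T -> V) s :
  sum_splits (fun u c => sum_splits (fun a b => P a b c) u) s =
  sum_splits (fun a t => sum_splits (P a) t) s.
Proof.
elim: s P => [|x s IHs] P; first by rewrite !sum_splits_nil.
rewrite !sum_splits_cons sum_splits_nil -IHs -addrA -sum_splitsD.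
by congr (_ + _); apply: eq_sum_splits => a b; rewrite sum_splits_cons.
Qed.

Lemma sum_splits_cat P a y c :
  sum_splits P (a ++ y :: c) =
  sum_splits (fun a1 a2 => P a1 (a2 ++ y :: c)) a
  + sum_splits (fun c1 c2 => P (a ++ y :: c1) c2) c.
Proof.
elim: a P => [|x a IHa] P /=; first by rewrite sum_splits_cons sum_splits_nil.
by rewrite !sum_splits_cons IHa addrA.
Qed.

End SumSplits.

(** * Contracting a factor of a word *)

Section Insertion.
Variable V : zmodType.
Implicit Types (F G H : seq V -> V) (s : seq V).

Definition insertion F G s : V :=
  sum_splits (fun a t => sum_splits (fun b c => F (a ++ G b :: c)) t) s.

Definition insertion2 F G H s : V :=
  sum_splits (fun a t => sum_splits (fun b u => sum_splits (fun c v =>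
    sum_splits (fun d e => F (a ++ G b :: c ++ H d :: e)) v) u) t) s.

Definition letterwise_additive F : Prop :=
  forall a c, {morph (fun y => F (a ++ y :: c)) : u v / u + v}.

Lemma letterwise_additive0 F a c :
  letterwise_additive F -> F (a ++ 0 :: c) = 0.
Proof.
by move=> Fadd; apply: (@addrI _ (F (a ++ 0 :: c))); rewrite -Fadd !addr0.
Qed.

Lemma letterwise_additive_sum_splits F a c P s : letterwise_additive F ->
  F (a ++ sum_splits P s :: c) =
  sum_splits (fun b d => F (a ++ P b d :: c)) s.
Proof.
move=> Fadd; rewrite /sum_splits.
by rewrite (big_morph _ (Fadd a c) (letterwise_additive0 a c Fadd)).
Qed.

(** The three terms are the three positions of the factor given to [G] relative
    to the letter produced by [H]: around it, before it, after it. *)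
Lemma insertion_comp F G H s : letterwise_additive F ->
  insertion (insertion F G) H s =
  insertion F (insertion G H) s + (insertion2 F G H s + insertion2 F H G s).
Proof.
move=> Fadd; pose before a1 r w b c := F (a1 ++ G r :: w ++ H b :: c).
pose around a1 a2 b c1 c2 := F (a1 ++ G (a2 ++ H b :: c1) :: c2).
pose after a b c1 r w := F (a ++ H b :: c1 ++ G r :: w).
have positions a b c : insertion F G (a ++ H b :: c) =
    sum_splits (fun a1 a2 => sum_splits (fun c1 c2 => around a1 a2 b c1 c2) c) a
    + (sum_splits (fun a1 a2 => sum_splits (fun r w => before a1 r w b c) a2) a
       + sum_splits (fun c1 q => sum_splits (after a b c1) q) c).
  rewrite /insertion sum_splits_cat addrA -sum_splitsD; congr (_ + _).
    by apply: eq_sum_splits => a1 a2; rewrite sum_splits_cat addrC.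
  by do 2![apply: eq_sum_splits => ? ?]; rewrite -catA.
rewrite {1}/insertion.
under eq_sum_splits do under eq_sum_splits do rewrite positions.
under eq_sum_splits do rewrite !sum_splitsD.
rewrite !sum_splitsD; congr (_ + (_ + _)).
(* The case of a later factor is insertion2 F H G as it stands.  In the other
   two, both sides are brought to the form where every cut is made in the right
   part of the previous one. *)
- under eq_sum_splits do rewrite exchange_sum_splits.
  rewrite sum_splitsA; apply: eq_sum_splits => a1 q.
  under [RHS]eq_sum_splits do rewrite letterwise_additive_sum_splits //.
  rewrite sum_splitsA; apply: eq_sum_splits => a2 t.
  under [RHS]eq_sum_splits do rewrite letterwise_additive_sum_splits //.
  by rewrite sum_splitsA.
under eq_sum_splits do rewrite exchange_sum_splits.
rewrite sum_splitsA; apply: eq_sum_splits => a1 q.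
under eq_sum_splits do rewrite exchange_sum_splits.
by rewrite sum_splitsA.
Qed.

End Insertion.

(** * Series as functions on words *)

Section Evaluation.
Variables (K : fieldType) (B : lmodType K).
Implicit Types (f g : Mult B) (s : seq B).

Definition ev f s : B := f (size s) (in_tuple s).

Lemma ev_tuple f n (t : n.-tuple B) s : tval t = s -> f n t = ev f s.
Proof.
case: t => /= r rn <- {s}; have size_r := eqP rn.
by case: n / size_r rn => rn; rewrite /ev; congr (f _ _); apply: val_inj.
Qed.

Lemma ev_linear f a c : linear (fun y => ev f (a ++ y :: c)).
Proof.
move=> k u v /=; set n := size (a ++ 0 :: c).
have an : (size a < n)%N by rewrite /n size_cat /=; lia.
have tsetE y :
    tval (tset (in_tuple (a ++ 0 :: c)) (Ordinal an) y) = a ++ y :: c.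
  apply: (@eq_from_nth B 0) => [|i _]; first by rewrite size_tuple !size_cat.
  rewrite nth_tset /= !nth_cat; case: ltngtP => // [ai|->].
    by rewrite -(subnSK ai).
  by rewrite subnn.
by rewrite -!(ev_tuple f (tsetE _)) multmapP.
Qed.

Lemma ev_letterwise_additive f : letterwise_additive (ev f).
Proof. by move=> a c u v; have := ev_linear f a c 1 u v; rewrite !scale1r. Qed.

Lemma ev_nil (f : ginv B) : ev f [::] = 0.
Proof. by case: f => f /= /eqP f0; rewrite /ev f0. Qed.

Lemma eq_ginv (f g : ginv B) : (forall s, ev f s = ev g s) -> f = g.
Proof.
move=> fg; apply: val_inj; apply: functional_extensionality_dep => n.
by apply: val_inj; apply: funext => x /=; rewrite !(ev_tuple _ erefl).
Qed.

Lemma slice_take s i m : (i + m <= size s)%N ->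
  tval (slice (in_tuple s) i m) = take m (drop i s).
Proof.
move=> ims; apply: (@eq_from_nth B 0).
  by rewrite size_tuple size_takel // size_drop; lia.
move=> j; rewrite size_tuple => jm.
by rewrite -[j]/(val (Ordinal jm)) -tnth_nth tnth_mktuple nth_take ?nth_drop.
Qed.

Lemma plug_cat s i m n y : (i + m <= size s)%N -> (n + m = (size s).+1)%N ->
  tval (plug (in_tuple s) i m n y) = take i s ++ y :: drop m (drop i s).
Proof.
move=> ims nms; rewrite drop_drop [(m + i)%N]addnC; apply: (@eq_from_nth B 0).
  by rewrite size_tuple size_cat /= size_takel ?size_drop; lia.
move=> j; rewrite size_tuple => jn.
by rewrite -[j]/(val (Ordinal jn)) -tnth_nth tnth_mktuple.
Qed.

(** The bracket is indexed by the arities of the two maps; here its terms are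
    reindexed by the position and the length of the contracted factor.  The
    length 0 is allowed on the right, and is harmless since [g_0 = 0]. *)
Lemma ev_bracket (f g : ginv B) s :
  ev (bracket f g) s = insertion (ev f) (ev g) s.
Proof.
set N := size s; pose P i m := ev f (take i s ++ ev g (take m (drop i s))
                                       :: drop m (drop i s)).
have P0 i : P i 0%N = 0.
  by rewrite /P take0 ev_nil letterwise_additive0 //; apply: ev_letterwise_additive.
transitivity (\sum_(0 <= i < N.+1) \sum_(0 <= m < N.+1 | (i + m <= N)%N) P i m).
  rewrite (exchange_big_dep predT) //= [RHS]big_nat_recl //.
  rewrite [X in _ = X + _]big1 => [|i _]; last exact: P0.
  rewrite add0r /ev /= /bracket_fun (exchange_big_dep predT) //=.
  rewrite big_add1 big_nat [RHS]big_nat; apply: eq_bigr => m /= mN.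
  (* The arity of the outer map is determined by that of the inner one. *)
  rewrite (eq_bigl (fun n => n == N - m)%N) => [|n]; last by rewrite /= -/N; lia.
  rewrite big_nat1_eq ifT; last by rewrite -/N; lia.
  transitivity (\sum_(0 <= i < N - m) P i m.+1).
    rewrite big_mkord; apply: eq_bigr => i _; have iNm := ltn_ord i.
    rewrite (ev_tuple f (plug_cat _ _ _)) ?(ev_tuple g (slice_take _)) //;
      rewrite -/N; lia.
  rewrite [LHS](big_nat_widen _ _ N.+1); last by lia.
  by apply: eq_bigl => i /=; lia.
rewrite big_mkord; apply: eq_bigr => i _; rewrite [RHS]/sum_splits size_drop -/N.
have iN := ltn_ord i.
rewrite -(big_mkord predT (P i)) [RHS](big_nat_widen _ _ N.+1); last by lia.
by apply: eq_bigl => m /=; lia.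
Qed.

End Evaluation.

Theorem proposition4p3 (K : fieldType) (K_char0 : [pchar K]%R =i pred0)
    (B : algType K) : right_preLie (@bracket K B).
Proof.
have evD (a : K) (f g : ginv B) s : ev (a *: f + g) s = a *: ev f s + ev g s.
  by [].
split=> [g a f f'|f a g g'|f g h].
- apply: eq_ginv => s; rewrite evD !ev_bracket /insertion.
  rewrite /sum_splits scaler_sumr -big_split; apply: eq_bigr => i _.
  by rewrite scaler_sumr -big_split; apply: eq_bigr => j _; rewrite evD.
- apply: eq_ginv => s; rewrite evD !ev_bracket /insertion.
  rewrite /sum_splits scaler_sumr -big_split; apply: eq_bigr => i _.
  rewrite scaler_sumr -big_split; apply: eq_bigr => j _.
  by rewrite evD ev_linear.
have ev_bracketr (u v w : ginv B) s :
    ev (bracket u (bracket v w)) s = insertion (ev u) (insertion (ev v) (ev w)) s.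
  by rewrite ev_bracket; congr insertion; apply: funext => t; apply: ev_bracket.
have ev_bracketl (u v w : ginv B) s :
    ev (bracket (bracket u v) w) s = insertion (insertion (ev u) (ev v)) (ev w) s.
  by rewrite ev_bracket; congr insertion; apply: funext => t; apply: ev_bracket.
have evB (u v : ginv B) s : ev (u - v) s = ev u s - ev v s by [].
apply: eq_ginv => s; rewrite !evB !ev_bracketr !ev_bracketl.
rewrite !insertion_comp; try exact: ev_letterwise_additive.
by rewrite !opprD !addNKr [in RHS]addrC.
Qed.
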